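(* Let $X$, $Y$ be real vector spaces and let $f:X\to Y$ be a function. Then $f$ satisfies $$4\big(f(3x+y)+f(3x-y)\big)=-12\big(f(x+y)+f(x-y)\big)+12\big(f(2x+y)+f(2x-y)\big)-8f(y)-192f(x)+f(2y)+30f(2x)$$ for all $x,y\in X$ if and only if there exist a unique symmetric multi-additive function $Q:X\times X\times X\times X\to Y$ and a unique function $C:X\times X\times X\to Y$ such that $C$ is symmetric for each fixed one variable and is additive for fixed two variables, and $f(x)=Q(x,x,x,x)+C(x,x,x)$ for all $x\in X$.
   Context: A function $Q:X^4\to Y$ is symmetric multi-additive if it is invariant under all permutations of its arguments and is additive in each argument when the other three are fixed. A function $C:X^3\to Y$ is ''symmetric for each fixed one variable'' if, whenever any one of its three variables is held fixed, it is symmetric in the remaining two; it is ''additive for fixed two variables'' if, whenever any two of its variables are held fixed, it is additive in the remaining one. *)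

(* Defs.v *)
From mathcomp Require Import all_boot all_order all_algebra all_fingroup.
From mathcomp Require Import reals.
Set Implicit Arguments.
Unset Strict Implicit.
Unset Printing Implicit Defensive.
Import GRing.Theory.
Local Open Scope ring_scope.

Definition symmetric4 (X Y : Type) (Q : X -> X -> X -> X -> Y) : Prop :=
  forall (s : 'S_4) (x : 'I_4 -> X),
    Q (x (s 0)) (x (s 1)) (x (s 2)) (x (s 3)) = Q (x 0) (x 1) (x 2) (x 3).

Definition additive4 (X Y : zmodType) (Q : X -> X -> X -> X -> Y) : Prop :=
  [/\ forall b c d, {morph (fun a => Q a b c d) : u v / u + v},
      forall a c d, {morph (fun b => Q a b c d) : u v / u + v},
      forall a b d, {morph (fun c => Q a b c d) : u v / u + v}
    & forall a b c, {morph (fun d => Q a b c d) : u v / u + v}].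

Definition symmetric_multi_additive4 (X Y : zmodType)
    (Q : X -> X -> X -> X -> Y) : Prop :=
  symmetric4 Q /\ additive4 Q.

Definition symmetric_fixing_one (X Y : Type) (C : X -> X -> X -> Y) : Prop :=
  [/\ forall a b c, C a b c = C a c b,
      forall b a c, C a b c = C c b a
    & forall c a b, C a b c = C b a c].

Definition additive_fixing_two (X Y : zmodType) (C : X -> X -> X -> Y) : Prop :=
  [/\ forall b c, {morph (fun a => C a b c) : u v / u + v},
      forall a c, {morph (fun b => C a b c) : u v / u + v}
    & forall a b, {morph (fun c => C a b c) : u v / u + v}].

(* Main.v *)
Require Import Defs.
From mathcomp Require Import all_boot all_order all_algebra all_fingroup.
From mathcomp Require Import reals.
From mathcomp Require Import boolp ring lra.
Set Implicit Arguments.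
Unset Strict Implicit.
Unset Printing Implicit Defensive.
Import GRing.Theory.
Local Open Scope ring_scope.

(** Why the theorem is true.  Write D_a f (x) = f (x + a) - f x.

    A solution is a generalized polynomial.  The equation is a linear relation
    between terms F_i (a_i x + b_i y) whose directions (a_i, b_i) are pairwise
    non-parallel.  Moving (x, y) by a vector that leaves the argument of one
    term fixed, and subtracting, removes that term and replaces the others by
    differences of themselves.  Removing in this way every term but f (x + y)
    shows that all sevenfold mixed differences of f vanish
    ([degree_lt_elimination], [solves_degree_lt]).

    Parity and homogeneity give the exact degree.  The even part g and the odd
    part h of f are again solutions; putting x = 0 or y = 0 yields
    g (2 x) = 16 g x, g (3 x) = 81 g x, h (2 x) = 8 h x, h (3 x) = 27 h x.  The
    top-order difference of a function of degree at most n is additive in each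
    step, hence gains a factor 2 ^ n when the steps are doubled, while
    homogeneity makes that factor 16 (or 8).  So it vanishes unless n = 4 (or
    n = 3), and the degree drops ([degree_lt_homogeneous]): g has degree at
    most 4 and h degree at most 3.

    Then Q a b c d = D_a D_b D_c D_d g 0 / 24 and C a b c = D_a D_b D_c h 0 / 6
    are symmetric and additive in each variable, and on the diagonal the values
    of g and h at 2 x, 3 x and 4 x give back g x and h x.

    Uniqueness: the diagonals of Q and C are the even and the odd part of f, and
    a symmetric multi-additive map is determined by its diagonal
    ([quartic_polarization], [cubic_polarization]).  Conversely, the diagonals
    satisfy the equation because their symmetric sums at u + v and u - v are
    explicit ([quartic_parallelogram], [cubic_parallelogram]). *)

(** * Linear identities in a module *)

(** Syntax of linear combinations over an environment of atoms, with
    coefficients in [R]; [lmod] below decides an identity between two of them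
    by comparing the coefficients of every atom. *)
Inductive lexp (R : Type) : Type :=
| LVar of nat
| LZero
| LAdd of lexp R & lexp R
| LOpp of lexp R
| LScale of R & lexp R.
Arguments LVar {R}.
Arguments LZero {R}.

Section Reflection.
Variables (R : pzRingType) (V : lmodType R).

Fixpoint lexp_eval (v : seq V) (t : lexp R) : V :=
  match t with
  | LVar i => v`_i
  | LZero => 0
  | LAdd t1 t2 => lexp_eval v t1 + lexp_eval v t2
  | LOpp t1 => - lexp_eval v t1
  | LScale c t1 => c *: lexp_eval v t1
  end.

Fixpoint lexp_coef (i : nat) (t : lexp R) : R :=
  match t with
  | LVar j => if Nat.eqb i j then 1 else 0
  | LZero => 0
  | LAdd t1 t2 => lexp_coef i t1 + lexp_coef i t2
  | LOpp t1 => - lexp_coef i t1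
  | LScale c t1 => c * lexp_coef i t1
  end.

Fixpoint lexp_coefs_eq (n : nat) (t u : lexp R) : Prop :=
  if n is m.+1 then lexp_coef m t = lexp_coef m u /\ lexp_coefs_eq m t u
  else True.

Lemma lexp_evalE (v : seq V) (t : lexp R) :
  lexp_eval v t = \sum_(i < size v) lexp_coef i t *: v`_i.
Proof.
elim: t => [j||t1 IH1 t2 IH2|t IH|c t IH] /=.
- have eqbE m n : Nat.eqb m n = (m == n) by elim: m n => [|m IH] [|n] //=.
  have [ltjv|levj] := ltnP j (size v).
    rewrite (bigD1 (Ordinal ltjv)) //= eqbE eqxx scale1r big1 ?addr0 // => i.
    by rewrite -val_eqE /= eqbE => /negPf ->; rewrite scale0r.
  rewrite nth_default // big1 // => i _; rewrite eqbE.
  by rewrite ltn_eqF ?scale0r // (leq_trans (ltn_ord i)).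
- by rewrite big1 // => i _; rewrite scale0r.
- by rewrite IH1 IH2 -big_split; apply: eq_bigr => i _; rewrite scalerDl.
- by rewrite IH -sumrN; apply: eq_bigr => i _; rewrite scaleNr.
- by rewrite IH scaler_sumr; apply: eq_bigr => i _; rewrite scalerA.
Qed.

Lemma lexp_sound (v : seq V) (t u : lexp R) :
  lexp_coefs_eq (size v) t u -> lexp_eval v t = lexp_eval v u.
Proof.
move=> eq_tu; rewrite !lexp_evalE; apply: eq_bigr => -[i ltiv] _ /=.
congr (_ *: _); elim: (size v) ltiv eq_tu => //= n IH.
by rewrite ltnS leq_eqVlt => /predU1P[->|/IH{}IH] [].
Qed.

(** Reduces a consequence of a linear hypothesis to an identity that holds
    formally; [k] is the multiplier of the hypothesis. *)
Lemma eq_lincomb (k : R) (l r a b : V) :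
  l = r -> a = b + k *: (l - r) -> a = b.
Proof. by move=> -> ->; rewrite subrr scaler0 addr0. Qed.

End Reflection.

(* Atoms are compared up to conversion, as the same operation may be reached
   through different paths of the algebraic hierarchy. *)
Ltac lmod_index a v :=
  match v with
  | ?b :: _ => let _ := match goal with _ => unify a b end in constr:(0%N)
  | _ :: ?w => let n := lmod_index a w in constr:(S n)
  end.

Ltac lmod_insert a v :=
  match v with
  | _ => let _ := lmod_index a v in v
  | _ => constr:(a :: v)
  end.

Ltac lmod_atoms t v :=
  match t with
  | ?a + ?b => let w := lmod_atoms b v in lmod_atoms a w
  | - ?a => lmod_atoms a v
  | ?c *: ?a => lmod_atoms a v
  | 0 => v
  | _ => lmod_insert t v
  end.

Ltac lmod_reify R t v :=
  match t with
  | ?a + ?b =>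
      let a' := lmod_reify R a v in let b' := lmod_reify R b v in
      constr:(@LAdd R a' b')
  | - ?a => let a' := lmod_reify R a v in constr:(@LOpp R a')
  | ?c *: ?a => let a' := lmod_reify R a v in constr:(@LScale R c a')
  | 0 => constr:(@LZero R)
  | _ => let n := lmod_index t v in constr:(@LVar R n)
  end.

(** The module [V] is an argument because the carrier of the goal may appear
    under a different structure of the hierarchy. *)
Ltac lmod V :=
  match goal with
  | |- ?a = ?b =>
    let R := match type of V with GRing.Lmodule.type ?R => R end in
    let S := constr:(GRing.PzRing.sort R) in
    let v0 := constr:(@nil (GRing.Lmodule.sort V)) in
    let v1 := lmod_atoms b v0 in
    let v := lmod_atoms a v1 in
    let t := lmod_reify S a v in
    let u := lmod_reify S b v in
    change (@lexp_eval R V v t = @lexp_eval R V v u);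
    apply: lexp_sound;
    cbn [size lexp_coefs_eq lexp_coef Nat.eqb];
    repeat split; first [ring | lra | field]
  end.


(** * Iterated differences and generalized polynomials *)

Section Differences.
Variables (R : realFieldType) (X Y : lmodType R).
Implicit Types (f : X -> Y) (s t : seq X) (a b x : X).

Definition diff a f : X -> Y := fun x => f (x + a) - f x.

Definition diffs s f : X -> Y := foldr diff f s.

(** Generalized polynomials in the sense of Frechet.  The recursion trades one
    difference for one degree, as the inductions below do; [degree_ltP] is the
    form with all steps at once. *)
Fixpoint degree_lt (n : nat) f : Prop :=
  if n is m.+1 then forall a, degree_lt m (diff a f) else forall x, f x = 0.

Lemma diffC a b f : diff a (diff b f) = diff b (diff a f).
Proof. by apply: funext => x; rewrite /diff (addrAC x b a); lmod Y. Qed.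

Lemma diffs_diff s a f : diffs s (diff a f) = diff a (diffs s f).
Proof. by elim: s => //= b s ->; rewrite diffC. Qed.

Lemma diffs_perm s t f : perm_eq s t -> diffs s f = diffs t f.
Proof.
move: s t; apply: catCA_perm_subst => s1 s2 s3; rewrite /diffs !foldr_cat.
elim: s1 => [|a s1 /= ->] //=; elim: s2 => //= b s2 <-; exact: diffC.
Qed.

Lemma degree_ltP n f :
  degree_lt n f <-> (forall s, size s = n -> forall x, diffs s f x = 0).
Proof.
elim: n f => [|n IH] f /=.
  by split=> [f0 [|//] _ //|f0]; apply: (f0 [::]).
split=> [fdeg [//|a s] [sz_s] x /=|f0 a].
  by rewrite -diffs_diff; have /IH := fdeg a; apply.
apply/IH => s sz_s x; rewrite diffs_diff.
by apply: (f0 (a :: s)); rewrite /= sz_s.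
Qed.

Lemma diff_addl a b f x :
  diff (a + b) f x = diff a f x + diff b f x + diff a (diff b f) x.
Proof. by rewrite /diff addrA; lmod Y. Qed.

(** The defect of additivity in one step is a difference of order one higher,
    so top-order differences are additive in each step. *)
Lemma diffs_additive s a b f x : degree_lt (size s).+2 f ->
  diffs (a + b :: s) f x = diffs (a :: s) f x + diffs (b :: s) f x.
Proof.
move=> /degree_ltP fdeg; rewrite /= diff_addl.
by rewrite [X in _ + X](fdeg [:: a, b & s]) // addr0.
Qed.

(** In a relation F (alpha x + beta y) + sum of F_i (alpha_i x + beta_i y) = 0,
    every direction other than (alpha, beta) can be eliminated at the cost of
    one difference of F: translating (x, y) by a vector (u, v) annihilated by
    (alpha_1, beta_1) and subtracting deletes F_1, and turns F into a difference
    with step alpha u + beta v, which is arbitrary because the two directions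
    are not parallel. *)
Lemma degree_lt_elimination (alpha beta : R) (F : X -> Y)
    (L : seq (R * R * (X -> Y))) :
  alpha != 0 ->
  all (fun t : R * R * (X -> Y) => alpha * t.1.2 - beta * t.1.1 != 0) L ->
  (forall x y,
     F (alpha *: x + beta *: y) +
     \sum_(p <- L) p.2 (p.1.1 *: x + p.1.2 *: y) = 0) ->
  degree_lt (size L) F.
Proof.
move=> al0; move sz_L: (size L) => n.
elim: n F L sz_L => [|n IH] F [|[[alpha1 beta1] F1] L] //=.
  move=> _ _ F0 x; have := F0 (alpha^-1 *: x) 0.
  by rewrite big_nil addr0 scaler0 addr0 scalerA mulfV // scale1r.
move=> [sz_L] /andP[d0 nondeg] F0 h.
(* Solves alpha1 u + beta1 v = 0, alpha u + beta v = h by Cramer's rule. *)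
set d := alpha * beta1 - beta * alpha1 in d0.
pose u := (beta1 / d) *: h; pose v := - (alpha1 / d) *: h.
have shift0 : alpha1 *: u + beta1 *: v = 0 by rewrite /u /v; lmod X.
have shift1 : alpha *: u + beta *: v = h.
  by rewrite -[RHS](scale1r h) -(divff d0) /u /v /d; lmod X.
pose D (t : R * R * (X -> Y)) := (t.1, diff (t.1.1 *: u + t.1.2 *: v) t.2).
apply: (IH _ (map D L)); rewrite ?size_map ?all_map //.
have shiftE (a b : R) x y :
    a *: (x + u) + b *: (y + v) = a *: x + b *: y + (a *: u + b *: v).
  by lmod X.
move=> x y; have E := F0 x y; have Eshift := F0 (x + u) (y + v).
rewrite !big_cons /= in E Eshift.
rewrite !shiftE shift0 shift1 addr0 in Eshift.
rewrite big_map (eq_bigr (fun p : R * R * (X -> Y) =>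
  p.2 (p.1.1 *: (x + u) + p.1.2 *: (y + v)) - p.2 (p.1.1 *: x + p.1.2 *: y))).
  rewrite sumrB /diff; apply: (eq_lincomb (k := 1) Eshift).
  by apply: (eq_lincomb (k := -1) E); lmod Y.
by move=> p _; rewrite shiftE.
Qed.

Lemma diffs_dilate (s : seq X) f x : degree_lt (size s).+1 f ->
  diffs [seq 2 *: a | a <- s] f x = 2 ^+ size s *: diffs s f x.
Proof.
elim: s f x => [|a s IH] f x fdeg /=; first by rewrite expr0 scale1r.
have -> : 2 *: a = a + a by lmod X.
rewrite -diffs_diff IH; last exact: fdeg.
rewrite diffs_diff [diff (a + a) _ x](@diffs_additive s a a f x fdeg).
by rewrite exprS; lmod Y.
Qed.

(** The constant top-order difference is multiplied by [2 ^+ n] when its steps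
    are doubled, and by [c] by homogeneity, so it is zero unless the two
    factors agree. *)
Lemma degree_lt_homogeneous n (c : R) f :
  (forall x, f (2 *: x) = c *: f x) -> 2 ^+ n != c ->
  degree_lt n.+1 f -> degree_lt n f.
Proof.
move=> f2 neq fdeg; apply/degree_ltP => s sz_s x.
have dilate t y : diffs [seq 2 *: a | a <- t] f (2 *: y) = c *: diffs t f y.
  by elim: t y => //= a t IH y; rewrite /diff -scalerDr !IH; lmod Y.
have at0 : diffs s f 0 = 0.
  have := dilate s 0; rewrite scaler0 diffs_dilate ?sz_s // => E.
  have /eqP: (2 ^+ n - c) *: diffs s f 0 = 0.
    by apply: (eq_lincomb (k := 1) E); lmod Y.
  by rewrite scaler_eq0 subr_eq0 (negPf neq) => /eqP.
(* A top-order difference is constant, so its value at 0 suffices. *)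
have /degree_ltP/(_ (x :: s)) := fdeg; rewrite /= sz_s => /(_ erefl 0).
by rewrite /diff add0r at0 subr0.
Qed.
End Differences.

(** * Solutions of the functional equation *)

Section Equation.
Import Order.TTheory.
Variables (R : realFieldType) (X Y : lmodType R).
Implicit Types (f : X -> Y) (x y : X).

Definition solves f : Prop := forall x y : X,
  4 *: (f (3 *: x + y) + f (3 *: x - y)) =
    - 12 *: (f (x + y) + f (x - y))
    + 12 *: (f (2 *: x + y) + f (2 *: x - y))
    - 8 *: f y - 192 *: f x + f (2 *: y) + 30 *: f (2 *: x).

(** The bound 7 is the number of directions occurring in the equation besides
    that of f (x + y). *)
Lemma solves_degree_lt f : solves f -> degree_lt 7 f.
Proof.
move=> fE.
(* The equation divided by 12, solved for f (x + y); terms of equal direction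
   are merged. *)
apply: (@degree_lt_elimination R X Y 1 1 f
  [:: (3, 1, fun z => 3^-1 *: f z); (3, -1, fun z => 3^-1 *: f z);
      (1, -1, f); (2, 1, fun z => - f z); (2, -1, fun z => - f z);
      (0, 1, fun z => (8 / 12) *: f z - 12^-1 *: f (2 *: z));
      (1, 0, fun z => 16 *: f z - (30 / 12) *: f (2 *: z))]).
- exact: oner_neq0.
- by rewrite /= !neq_lt; lra.
move=> x y; rewrite !big_cons big_nil /=.
rewrite !scale1r !scaleN1r !scale0r !add0r !addr0.
by apply: (eq_lincomb (k := 12^-1) (fE x y)); lmod Y.
Qed.

(** The equation is invariant under (x, y) |-> (- x, - y); the cases [c = 1] and
    [c = -1] are the even and the odd part of [f]. *)
Lemma solves_parity (c : R) f :
  solves f -> solves (fun x => 2^-1 *: (f x + c *: f (- x))).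
Proof.
move=> fE x y.
have oppD (u v : X) : - u - v = - (u + v) by rewrite opprD.
have oppB (u v : X) : - u - - v = - (u - v) by rewrite opprB opprK addrC.
have scaleN (k : R) (u : X) : k *: - u = - (k *: u) by rewrite scalerN.
have := fE (- x) (- y); rewrite !(scaleN 2 x, scaleN 3 x, scaleN 2 y).
rewrite !(oppD x, oppB x, oppD (2 *: x), oppB (2 *: x)).
rewrite (oppD (3 *: x)) (oppB (3 *: x)).
move=> E; apply: (eq_lincomb (k := 2^-1) (fE x y)).
by apply: (eq_lincomb (k := c / 2) E); lmod Y.
Qed.

Lemma solves0 f : solves f -> f 0 = 0.
Proof.
move=> fE; have := fE 0 0; rewrite !scaler0 subrr addr0 => E.
by apply: (eq_lincomb (k := 177^-1) E); lmod Y.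
Qed.

Section Even.
Variable g : X -> Y.
Hypotheses (gE : solves g) (g_even : forall x, g (- x) = g x).

Lemma even_solution2 x : g (2 *: x) = 16 *: g x.
Proof.
have := gE 0 x; rewrite !scaler0 !add0r (solves0 gE) g_even => E.
by apply: (eq_lincomb (k := -1) E); lmod Y.
Qed.

Lemma even_solution3 x : g (3 *: x) = 81 *: g x.
Proof.
have := gE x 0; rewrite scaler0 !subr0 !addr0 (solves0 gE) even_solution2 => E.
by apply: (eq_lincomb (k := 8^-1) E); lmod Y.
Qed.

Lemma even_solution_degree_lt : degree_lt 5 g.
Proof.
have step n : (2 : R) ^+ n != 16 -> degree_lt n.+1 g -> degree_lt n g.
  exact/degree_lt_homogeneous/even_solution2.
do 2 (apply: (step); first by (rewrite neq_lt; lra)).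
exact: solves_degree_lt.
Qed.

(** With the homogeneity factors of 4, 3 and 2, the fourth difference at 0 is
    (256 - 4 * 81 + 6 * 16 - 4) g x = 24 g x. *)
Lemma even_solution_diagonal x : 24^-1 *: diffs [:: x; x; x; x] g 0 = g x.
Proof.
rewrite /= /diff !add0r (solves0 gE).
have -> : x + x = 2 *: x by lmod X.
have -> : 2 *: x + x = 3 *: x by lmod X.
have -> : 3 *: x + x = 2 *: (2 *: x) by lmod X.
by rewrite !even_solution2 even_solution3; lmod Y.
Qed.
End Even.

Section Odd.
Variable h : X -> Y.
Hypotheses (hE : solves h) (h_odd : forall x, h (- x) = - h x).

Lemma odd_solution2 x : h (2 *: x) = 8 *: h x.
Proof.
have := hE 0 x; rewrite !scaler0 !add0r (solves0 hE) h_odd => E.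
by apply: (eq_lincomb (k := -1) E); lmod Y.
Qed.

Lemma odd_solution3 x : h (3 *: x) = 27 *: h x.
Proof.
have := hE x 0; rewrite scaler0 !subr0 !addr0 (solves0 hE) odd_solution2 => E.
by apply: (eq_lincomb (k := 8^-1) E); lmod Y.
Qed.

Lemma odd_solution_degree_lt : degree_lt 4 h.
Proof.
have step n : (2 : R) ^+ n != 8 -> degree_lt n.+1 h -> degree_lt n h.
  exact/degree_lt_homogeneous/odd_solution2.
do 3 (apply: (step); first by (rewrite neq_lt; lra)).
exact: solves_degree_lt.
Qed.

(** With the homogeneity factors of 3 and 2, the third difference at 0 is
    (27 - 3 * 8 + 3) h x = 6 h x. *)
Lemma odd_solution_diagonal x : 6^-1 *: diffs [:: x; x; x] h 0 = h x.
Proof.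
rewrite /= /diff !add0r (solves0 hE).
have -> : x + x = 2 *: x by lmod X.
have -> : 2 *: x + x = 3 *: x by lmod X.
by rewrite odd_solution2 odd_solution3; lmod Y.
Qed.
End Odd.
End Equation.

(** * Symmetric multi-additive maps *)

Section AdditiveMaps.
Variables (R : realFieldType) (X Y : lmodType R) (F : X -> Y).
Hypothesis FD : {morph F : u v / u + v}.

Lemma morph_add0 : F 0 = 0.
Proof. by apply: (addrI (F 0)); rewrite -FD !addr0. Qed.

Lemma morph_addN u : F (- u) = - F u.
Proof. by apply: (addrI (F u)); rewrite -FD !subrr morph_add0. Qed.

Lemma morph_add_nat n u : F (n%:R *: u) = n%:R *: F u.
Proof.
elim: n => [|n IH]; first by rewrite !scale0r morph_add0.
by rewrite -addn1 natrD !scalerDl !scale1r FD IH.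
Qed.
End AdditiveMaps.

Lemma symmetric4_swaps (X Y : Type) (Q : X -> X -> X -> X -> Y) :
  symmetric4 Q ->
  [/\ forall a b c d, Q a b c d = Q b a c d,
      forall a b c d, Q a b c d = Q a c b d
    & forall a b c d, Q a b c d = Q a b d c].
Proof.
move=> Qs; split=> a b c d; pose x (i : 'I_4) := nth a [:: a; b; c; d] i.
- by have := Qs (tperm 0 1) x; rewrite !permE /x /=.
- by have := Qs (tperm 1 2) x; rewrite !permE /x /=.
- by have := Qs (tperm 2 3) x; rewrite !permE /x /=.
Qed.

Section Quartic.
Variables (R : realFieldType) (X Y : lmodType R) (Q : X -> X -> X -> X -> Y).
Hypothesis QP : symmetric_multi_additive4 Q.

Lemma quartic_dilate n u v :
  Q (n%:R *: u) (n%:R *: u) v v = (n%:R ^+ 2) *: Q u u v v.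
Proof.
case: QP => _ [D1 D2 _ _].
by rewrite (morph_add_nat (D1 _ _ _)) (morph_add_nat (D2 _ _ _)) scalerA.
Qed.

Lemma quartic_dilate4 n u :
  Q (n%:R *: u) (n%:R *: u) (n%:R *: u) (n%:R *: u) = (n%:R ^+ 4) *: Q u u u u.
Proof.
rewrite quartic_dilate; case: QP => _ [_ _ D3 D4].
by rewrite (morph_add_nat (D3 _ _ _)) (morph_add_nat (D4 _ _ _)); lmod Y.
Qed.

(** The terms of odd degree in [v] cancel in the sum. *)
Lemma quartic_parallelogram u v :
  Q (u + v) (u + v) (u + v) (u + v) + Q (u - v) (u - v) (u - v) (u - v) =
  2 *: Q u u u u + 12 *: Q u u v v + 2 *: Q v v v v.
Proof.
case: QP => /symmetric4_swaps[s12 s23 s34] [D1 D2 D3 D4].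
rewrite !(D1, D2, D3, D4) !(morph_addN (D1 _ _ _), morph_addN (D2 _ _ _),
  morph_addN (D3 _ _ _), morph_addN (D4 _ _ _)).
have e1 : Q u v u v = Q u u v v by rewrite s23.
have e2 : Q u v v u = Q u u v v by rewrite s34.
have e3 : Q v u u v = Q u u v v by rewrite s12 s23.
have e4 : Q v u v u = Q u u v v by rewrite s34 e3.
have e5 : Q v v u u = Q u u v v by rewrite s23 e4.
rewrite e1 e2 e3 e4 e5.
lmod Y.
Qed.

(** The parallelogram identity gives [Q u u v v = 0]; linearizing first in [v]
    and then in [u] reaches arbitrary arguments. *)
Lemma quartic_polarization :
  (forall x, Q x x x x = 0) -> forall a b c d, Q a b c d = 0.
Proof.
move=> Q0; case: QP => /symmetric4_swaps[s12 s23 s34] [D1 D2 D3 D4].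
have uuvv u v : Q u u v v = 0.
  have := quartic_parallelogram u v; rewrite !Q0 => E.
  by apply: (eq_lincomb (k := - 12^-1) E); lmod Y.
have uuvw u v w : Q u u v w = 0.
  have := uuvv u (v + w); rewrite D3 !D4 !uuvv (s34 _ _ w v) => E.
  by apply: (eq_lincomb (k := 2^-1) E); lmod Y.
move=> a b c d; have := uuvw (a + b) c d.
rewrite D1 !D2 !uuvw (s12 b a) => E.
by apply: (eq_lincomb (k := 2^-1) E); lmod Y.
Qed.
End Quartic.

Section Cubic.
Variables (R : realFieldType) (X Y : lmodType R) (C : X -> X -> X -> Y).
Hypotheses (C_sym : symmetric_fixing_one C) (C_add : additive_fixing_two C).

Lemma cubic_dilate n u v : C (n%:R *: u) v v = n%:R *: C u v v.
Proof. by case: C_add => D1 _ _; rewrite (morph_add_nat (D1 _ _)). Qed.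

Lemma cubic_dilate3 n u :
  C (n%:R *: u) (n%:R *: u) (n%:R *: u) = (n%:R ^+ 3) *: C u u u.
Proof.
rewrite cubic_dilate; case: C_add => _ D2 D3.
by rewrite (morph_add_nat (D2 _ _)) (morph_add_nat (D3 _ _)); lmod Y.
Qed.

Lemma cubic_opp u : C (- u) (- u) (- u) = - C u u u.
Proof.
case: C_add => D1 D2 D3.
rewrite (morph_addN (D1 _ _)) (morph_addN (D2 _ _)) (morph_addN (D3 _ _)).
by rewrite opprK.
Qed.

(** The terms of odd degree in [v] cancel in the sum. *)
Lemma cubic_parallelogram u v :
  C (u + v) (u + v) (u + v) + C (u - v) (u - v) (u - v) =
  2 *: C u u u + 6 *: C u v v.
Proof.
case: C_add C_sym => D1 D2 D3 [s23 _ s12].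
rewrite !(D1, D2, D3) !(morph_addN (D1 _ _), morph_addN (D2 _ _),
  morph_addN (D3 _ _)).
have e1 : C v u v = C u v v by rewrite s12.
have e2 : C v v u = C u v v by rewrite s23 e1.
rewrite e1 e2; lmod Y.
Qed.

(** The parallelogram identity gives [C u v v = 0], which is then linearized in
    [v]. *)
Lemma cubic_polarization :
  (forall x, C x x x = 0) -> forall a b c, C a b c = 0.
Proof.
move=> C0; case: C_add C_sym => D1 D2 D3 [s23 _ _].
have uvv u v : C u v v = 0.
  have := cubic_parallelogram u v; rewrite !C0 => E.
  by apply: (eq_lincomb (k := - 6^-1) E); lmod Y.
move=> a b c; have := uvv a (b + c); rewrite D2 !D3 !uvv (s23 a c b) => E.
by apply: (eq_lincomb (k := 2^-1) E); lmod Y.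
Qed.
End Cubic.

(** * Decomposition of the solutions *)

Section Decomposition.
Variables (R : realFieldType) (X Y : lmodType R).

Definition decomposes (f : X -> Y) (Q : X -> X -> X -> X -> Y)
    (C : X -> X -> X -> Y) : Prop :=
  [/\ symmetric_multi_additive4 Q, symmetric_fixing_one C, additive_fixing_two C
    & forall x, f x = Q x x x x + C x x x].

(** Both parts are known on f (n x + y) + f (n x - y), so the equation reduces
    to numerical identities between the coefficients for n = 1, 2, 3. *)
Lemma decomposes_solves f Q C : decomposes f Q C -> solves f.
Proof.
case=> QP Cs Ca fE x y.
have S n : f (n%:R *: x + y) + f (n%:R *: x - y) =
    (2 * n%:R ^+ 4) *: Q x x x x + (12 * n%:R ^+ 2) *: Q x x y y +
    2 *: Q y y y y + (2 * n%:R ^+ 3) *: C x x x + (6 * n%:R) *: C x y y.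
  rewrite !fE addrACA (quartic_parallelogram QP) (cubic_parallelogram Cs Ca).
  rewrite (quartic_dilate4 QP) (quartic_dilate QP).
  by rewrite (cubic_dilate3 Ca) (cubic_dilate Ca); lmod Y.
have := S 1%N; rewrite scale1r => ->; rewrite !S !fE.
by rewrite !(quartic_dilate4 QP) !(cubic_dilate3 Ca); lmod Y.
Qed.

(** Differences commute, which gives the symmetry; additivity in the first step
    then spreads to the others. *)
Lemma diffs_symmetric_multi_additive (k : R) (g : X -> Y) : degree_lt 5 g ->
  symmetric_multi_additive4 (fun a b c d => k *: diffs [:: a; b; c; d] g 0).
Proof.
move=> gdeg.
have Qs : symmetric4 (fun a b c d => k *: diffs [:: a; b; c; d] g 0).
  move=> s x; rewrite (@diffs_perm _ _ _ _ [:: x 0; x 1; x 2; x 3]) //.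
  have enum4 : [:: 0; 1; 2; 3] = enum 'I_4.
    by apply: (inj_map val_inj); rewrite val_enum_ord.
  have: perm_eq [seq s i | i <- enum 'I_4] (enum 'I_4).
    apply: uniq_perm; rewrite ?(map_inj_uniq perm_inj) ?enum_uniq //.
    move=> i; rewrite mem_enum -[i in LHS](permKV s).
    by rewrite (mem_map perm_inj) mem_enum.
  by rewrite -enum4 => /(perm_map x).
have [s12 s23 s34] := symmetric4_swaps Qs.
have D1 b c d :
    {morph (fun a => k *: diffs [:: a; b; c; d] g 0) : u v / u + v}.
  by move=> u v; rewrite (diffs_additive (s := [:: b; c; d])) // scalerDr.
have D2 a c d :
    {morph (fun b => k *: diffs [:: a; b; c; d] g 0) : u v / u + v}.
  by move=> u v; rewrite !(s12 a) D1.
have D3 a b d :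
    {morph (fun c => k *: diffs [:: a; b; c; d] g 0) : u v / u + v}.
  by move=> u v; rewrite !(s23 a b) D2.
split=> //; split=> // a b c u v; rewrite !(s34 a b c); exact: D3.
Qed.

Lemma diffs_symmetric_fixing_one (k : R) (h : X -> Y) :
  symmetric_fixing_one (fun a b c => k *: diffs [:: a; b; c] h 0).
Proof.
have perm s t : perm_eq s t -> k *: diffs s h 0 = k *: diffs t h 0.
  by move/diffs_perm => ->.
by split=> a b c; apply: perm; apply/seq.permP => p /=; ring.
Qed.

Lemma diffs_additive_fixing_two (k : R) (h : X -> Y) : degree_lt 4 h ->
  additive_fixing_two (fun a b c => k *: diffs [:: a; b; c] h 0).
Proof.
move=> hdeg; have [s23 s13 s12] := diffs_symmetric_fixing_one k h.
have D1 b c : {morph (fun a => k *: diffs [:: a; b; c] h 0) : u v / u + v}.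
  by move=> u v; rewrite (diffs_additive (s := [:: b; c])) // scalerDr.
split=> // [a c|a b] u v; first by rewrite !(s12 c a) D1.
by rewrite !(s13 b a) D1.
Qed.

Lemma solves_decomposes f : solves f -> exists Q C, decomposes f Q C.
Proof.
move=> fE.
pose part c x := 2^-1 *: (f x + c *: f (- x)).
have gE : solves (part 1) by exact: solves_parity.
have hE : solves (part (-1)) by exact: solves_parity.
have g_even x : part 1 (- x) = part 1 x by rewrite /part opprK; lmod Y.
have h_odd x : part (-1) (- x) = - part (-1) x by rewrite /part opprK; lmod Y.
exists (fun a b c d => 24^-1 *: diffs [:: a; b; c; d] (part 1) 0).
exists (fun a b c => 6^-1 *: diffs [:: a; b; c] (part (-1)) 0).
split.
- exact/diffs_symmetric_multi_additive/even_solution_degree_lt.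
- exact: diffs_symmetric_fixing_one.
- exact/diffs_additive_fixing_two/odd_solution_degree_lt.
move=> x; rewrite even_solution_diagonal // odd_solution_diagonal // /part.
by lmod Y.
Qed.

(** The even part of [f] is the diagonal of [Q], hence determines [Q]; the
    difference of two candidates for [C] then has zero diagonal. *)
Lemma decomposes_unique f Q C Q' C' :
  decomposes f Q C -> decomposes f Q' C' -> Q = Q' /\ C = C'.
Proof.
have parity Q0 C0 x : decomposes f Q0 C0 ->
    Q0 x x x x = 2^-1 *: (f x + f (- x)).
  case=> QP Cs Ca fE; rewrite !fE (cubic_opp Ca).
  have := quartic_parallelogram QP 0 x; rewrite add0r sub0r.
  have [_ [D1 _ _ _]] := QP.
  rewrite (morph_add0 (D1 0 0 0)) (morph_add0 (D1 0 x x)) => E.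
  by apply: (eq_lincomb (k := - 2^-1) E); lmod Y.
move=> dec dec'; have qE x : Q x x x x = Q' x x x x.
  by rewrite (parity _ _ _ dec) (parity _ _ _ dec').
have [QP Cs Ca fE] := dec; have [QP' Cs' Ca' fE'] := dec'.
split.
  do 4 (apply: funext => ?).
  apply/eqP; rewrite -subr_eq0; apply/eqP.
  apply: (@quartic_polarization R X Y (fun a b c d => Q a b c d - Q' a b c d)).
    case: QP QP' => Qs [D1 D2 D3 D4] [Qs' [D1' D2' D3' D4']].
    split; first by move=> s x; rewrite Qs Qs'.
    split=> a b c u v.
    - by rewrite D1 D1'; lmod Y.
    - by rewrite D2 D2'; lmod Y.
    - by rewrite D3 D3'; lmod Y.
    - by rewrite D4 D4'; lmod Y.
  by move=> x; rewrite qE subrr.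
do 3 (apply: funext => ?).
apply/eqP; rewrite -subr_eq0; apply/eqP.
apply: (@cubic_polarization R X Y (fun a b c => C a b c - C' a b c)).
- case: Cs Cs' => s23 s13 s12 [s23' s13' s12'].
  by split=> a b c; congr (_ - _).
- case: Ca Ca' => D1 D2 D3 [D1' D2' D3'].
  split=> a b u v.
  + by rewrite D1 D1'; lmod Y.
  + by rewrite D2 D2'; lmod Y.
  + by rewrite D3 D3'; lmod Y.
move=> x; have := fE' x; rewrite fE qE => /addrI ->; exact: subrr.
Qed.
End Decomposition.

Theorem theorem2p1 (R : realType) (X Y : lmodType R) (f : X -> Y) :
  (forall x y : X,
     4 *: (f (3 *: x + y) + f (3 *: x - y)) =
       - 12 *: (f (x + y) + f (x - y))
       + 12 *: (f (2 *: x + y) + f (2 *: x - y))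
       - 8 *: f y - 192 *: f x + f (2 *: y) + 30 *: f (2 *: x))
  <->
  (exists! QC : (X -> X -> X -> X -> Y) * (X -> X -> X -> Y),
     [/\ symmetric_multi_additive4 QC.1,
         symmetric_fixing_one QC.2,
         additive_fixing_two QC.2
       & forall x : X, f x = QC.1 x x x x + QC.2 x x x]).
Proof.
split=> [/solves_decomposes[Q [C dec]]|[[Q C] [dec _]]].
  exists (Q, C); split=> // -[Q' C'] dec'.
  by have [-> ->] := decomposes_unique dec dec'.
exact: (decomposes_solves dec).
Qed.
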